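(* Let $I=[a,b]$ be a compact interval and let $g:I\to\mathbb R$ be a left-continuous nondecreasing pure-jump function, so that $$g(t)-g(a)=\sum_{\tau\in[a,t)}\Delta^+g(\tau),\qquad t\in I.$$ Then $g(I)$ (with the subspace topology from $\mathbb R$) is zero-dimensional. Consequently, for every complete metric space $(X,d)$, every Hausdorff $g$-continuous map $F:I\to\mathcal K(X)$, and every $\theta\in I$ and $x_\theta\in F(\theta)$, there exists a $g$-continuous map $f:I\to X$ with $f(t)\in F(t)$ for every $t\in I$ and $f(\theta)=x_\theta$.
   Context: For $\tau\in[a,b)$, $\Delta^+g(\tau)=g(\tau+)-g(\tau)$ with $g(\tau+)=\lim_{r\downarrow\tau}g(r)$. Pure-jump means that the Stieltjes measure $\mu_g$, determined by $\mu_g([s,t))=g(t)-g(s)$, is purely atomic, equivalently that the displayed identity holds. $\mathcal K(X)$ is the family of all nonempty compact subsets of $X$, with Hausdorff distance $d_H$. $F:I\to\mathcal K(X)$ is (Hausdorff) $g$-continuous if for every $t\in I$ and $\varepsilon>0$ there is $\delta>0$ such that $d_H(F(s),F(t))<\varepsilon$ whenever $s\in I$ and $|g(s)-g(t)|<\delta$; for $f:I\to X$, $g$-continuity is the same with $d$ in place of $d_H$. A topological space is zero-dimensional if it has a base consisting of sets that are both open and closed. *)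

(* Defs.v *)
From HB Require Import structures.
From mathcomp Require Import all_boot all_order all_algebra.
From mathcomp Require Import all_classical all_reals all_analysis.

Set Implicit Arguments.
Unset Strict Implicit.
Unset Printing Implicit Defensive.

Import Order.TTheory GRing.Theory Num.Theory.
Import numFieldTopology.Exports numFieldNormedType.Exports.

Local Open Scope classical_set_scope.
Local Open Scope ring_scope.

#[short(type="completeMetricType")]
HB.structure Definition CompleteMetric (K : numFieldType) :=
  { M of Complete M & Metric K M }.

(* Not the library's [zero_dimensional], which only asks that distinct points
   be separated by a clopen set. *)
Definition zero_dimensional_space (T : topologicalType) :=
  exists B : set_system T, basis B /\ forall U, B U -> clopen U.

Section Functions_on_an_interval.
Context {R : realType}.
Implicit Types (a b : R) (g : R -> R).

(* A function on [a, b] is represented by a total function on R, of which only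
   the values on [a, b] matter. *)

Definition nondecreasing_on a b g :=
  {in `[a, b] &, {homo g : s t / s <= t}}.

Definition left_continuous_on a b g :=
  forall t, t \in `]a, b] -> g r @[r --> t^'-] --> g t.

Definition right_jump g (tau : R) : R := lim (g r @[r --> tau^'+]) - g tau.

(* The sum of a family of nonnegative terms over an arbitrary index set is the
   supremum of its finite partial sums, in the extended reals. *)
Definition pure_jump_on a b g :=
  forall t, t \in `[a, b] ->
    (g t - g a)%:E = (\esum_(tau in [set` `[a, t[]) (right_jump g tau)%:E)%E.

Definition g_continuous_on a b g (Y : Type) (dY : Y -> Y -> R) (h : R -> Y) :=
  forall t, t \in `[a, b] -> forall e, 0 < e ->
    exists2 delta, 0 < delta &
      forall s, s \in `[a, b] -> `|g s - g t| < delta -> dY (h s) (h t) < e.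

End Functions_on_an_interval.

Section Hausdorff_distance.
Context {R : realType} {X : metricType R}.
Implicit Types (x : X) (A B : set X).

Definition nonempty_compacts : set (set X) := [set A | A !=set0 /\ compact A].

Definition dist_to_set x B : R := inf [set mdist x y | y in B].

Definition hausdorff_excess A B : R := sup [set dist_to_set x B | x in A].

(* [inf] and [sup] are real-valued, with default value 0 on sets without a
   bound; on nonempty compact sets all the bounds exist. *)
Definition hausdorff_dist A B : R :=
  Num.max (hausdorff_excess A B) (hausdorff_excess B A).

End Hausdorff_distance.

(* Main.v *)
(* If [g s < g t], the pure-jump identity forces a jump of [g] somewhere in
   [[s, t)], and this jump leaves a gap in [g(I)] between [g s] and [g t].
   Hence the complement of [g(I)] is dense in the line, and the traces on [g(I)]
   of the intervals with endpoints outside [g(I)] are clopen; countably many of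
   them suffice for a base.

   A [g]-continuous map factors through [g], so [F] is a continuous map on
   [g(I)], and Michael's selection argument applies to it: using the countable
   clopen base, one builds locally constant [2^-n]-approximate selections that
   move by less than [2^-n] at the n-th step, and their limit is the selection. *)
Require Import Defs.
From HB Require Import structures.
From mathcomp Require Import all_boot all_order all_algebra.
From mathcomp Require Import all_classical all_reals all_analysis.
From mathcomp Require Import lra.

Import Order.TTheory GRing.Theory Num.Theory.
Import numFieldTopology.Exports numFieldNormedType.Exports.

Local Open Scope classical_set_scope.
Local Open Scope ring_scope.

(** * Selections over a space with a countable clopen base *)

Definition locally_constant {T : topologicalType} {Y : Type} (f : T -> Y) :=
  forall y : T, \forall z \near y, f z = f y.

(** The neighbourhood may depend on [x], unlike in Hausdorff continuity; this weaker notion survives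
    prescribing the selection at one point. *)
Definition lower_hemicontinuous {R : realType} {T : topologicalType}
    {X : metricType R} (F : T -> set X) :=
  forall (y : T) x, F y x -> forall e, 0 < e ->
    \forall z \near y, exists2 x', F z x' & mdist x x' < e.

(* Each point takes the value attached to the first admissible basic set
   containing it; as the basic sets are clopen, so is the locus where a given
   one is the first. *)
Lemma locally_constant_choice {T : topologicalType} {Y : Type}
    (B : nat -> set T) (Q : T -> Y -> Prop) :
  (forall n, clopen (B n)) -> basis (range B) ->
  (forall y : T, exists x, \forall z \near y, Q z x) ->
  exists2 f : T -> Y, locally_constant f & forall y, Q y (f y).
Proof.
move=> Bcl [_ Bbasis] Qloc.
pose adm n := exists x, forall z, B n z -> Q z x.
have /choice[N NP] y : exists n, [/\ adm n, B n y &
    forall m, adm m -> B m y -> (n <= m)%N].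
  have [x Qx] := Qloc y.
  have [_ [[n _ <-] Bny] BnQ] := Bbasis y _ Qx.
  have exn : exists n, `[< adm n /\ B n y >].
    by exists n; apply/asboolP; split => //; exists x.
  case: (ex_minnP exn) => m /asboolP[am Bm] mmin.
  by exists m; split => // k ak Bk; apply: mmin; apply/asboolP.
(* [v] below needs a default value at inadmissible indices, so an empty [T] is treated apart. *)
have [y0|noT] := pselect (exists y : T, True); last first.
  have T0 (y : T) : False by apply: noT; exists y.
  by exists (fun y => False_rect _ (T0 y)) => y; case: (T0 y).
have [x0 _] : exists x : Y, True.
  by case: y0 => y _; have [x _] := Qloc y; exists x.
have /choice[v vP] n : exists x, adm n -> forall z, B n z -> Q z x.
  by have [[x xP]|nadm] := pselect (adm n); [exists x|exists x0].
exists (v \o N) => [y|y]; last first.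
  by have [aN BN _] := NP y; exact: (vP _ aN).
have [aN BN Nmin] := NP y.
have Nle : \forall z \near y, (N z <= N y)%N.
  have : nbhs y (B (N y)) by apply: open_nbhs_nbhs; split => //; case: (Bcl (N y)).
  by apply: filterS => z Bz; have [_ _] := NP z; apply.
(* Finitely many basic sets precede index [N y]; the admissible ones miss [y] and, being closed,
   miss a neighbourhood of it. *)
have Nge k : (k <= N y)%N -> \forall z \near y, (k <= N z)%N.
  elim: k => [_|k IHk kN]; first exact: nearW.
  have notBk : \forall z \near y, ~ (adm k /\ B k z).
    have [ak|nak] := pselect (adm k); last by apply: nearW => z -[].
    have : nbhs y (~` B k).
      apply: open_nbhs_nbhs; split; first by rewrite openC; case: (Bcl k).
      by move=> Bk; have := Nmin k ak Bk; rewrite leqNgt kN.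
    by apply: filterS => z nB [].
  near=> z; rewrite ltn_neqAle; apply/andP; split; last first.
    by near: z; exact/IHk/ltnW.
  apply/eqP => kNz; have [aNz BNz _] := NP z.
  have : ~ (adm k /\ B k z) by near: z.
  by apply; rewrite kNz.
near=> z; rewrite /=; congr v; apply/eqP; rewrite eqn_leq; apply/andP; split.
  by near: z.
by near: z; exact: Nge.
Unshelve. all: by end_near. Qed.

Lemma near_expr2V_lt {R : realType} (e : R) : 0 < e ->
  \forall n \near \oo, 2^-1 ^+ n < e.
Proof.
move=> e0; have : (fun n => 2^-1 ^+ n : R) @ \oo --> (0 : R).
  by apply: cvg_expr; rewrite ger0_norm//; lra.
move=> /cvgrPdist_lt /(_ _ e0); apply: filterS => n.
by rewrite sub0r normrN ger0_norm// exprn_ge0//; lra.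
Qed.

(** Completeness gives the limit of the approximate selections, uniform convergence its continuity,
    and closedness of the values puts it in [F]. *)
Lemma zero_dimensional_selection {R : realType} {T : topologicalType}
    {X : completeMetricType R} (B : nat -> set T) (F : T -> set X) :
  (forall n, clopen (B n)) -> basis (range B) ->
  (forall y, F y !=set0) -> (forall y, closed (F y)) ->
  lower_hemicontinuous F ->
  exists2 f : T -> X, continuous f & forall y, F y (f y).
Proof.
move=> Bcl Bbasis F0 Fcl Flhc.
pose h n : R := 2^-1 ^+ n.
have h0 n : 0 < h n by apply: exprn_gt0; lra.
pose good n (f : T -> X) := locally_constant f /\
  forall y, exists2 x, F y x & mdist (f y) x < h n.
have [u0 good0] : exists f, good 0%N f.
  have [|f flc fP] := locally_constant_choice B
    (fun y x => exists2 x', F y x' & mdist x x' < h 0%N) Bcl Bbasis.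
    by move=> y; have [x Fx] := F0 y; exists x; exact: Flhc.
  by exists f.
(* The hypothesis [good] sits inside the existential, so that [s] is total and can be iterated
   without carrying proofs. *)
have /choice[s sP] (p : nat * (T -> X)) : exists f', good p.1 p.2 ->
    good p.1.+1 f' /\ forall y, mdist (p.2 y) (f' y) < h p.1.
  case: p => n f /=; have [gf|] := pselect (good n f); last by exists f.
  have [flc fP] := gf.
  have [|f' flc' f'P] := locally_constant_choice B
    (fun y x => mdist (f y) x < h n /\
                exists2 x', F y x' & mdist x x' < h n.+1) Bcl Bbasis.
    (* A point of [F y] within [h n] of [f y] serves on a whole neighbourhood, as [f] is constant
       near [y]. *)
    move=> y; have [x Fx fx] := fP y; exists x.
    near=> z; split; last by near: z; exact: Flhc.
    by have -> : f z = f y by near: z; exact: flc.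
  exists f' => _; split; last by move=> y; case: (f'P y).
  by split => // y; case: (f'P y).
pose u := fix u n := if n is m.+1 then s (m, u m) else u0.
have ugood n : good n (u n).
  by elim: n => //= n IHn; case: (sP (n, u n) IHn).
have ustep n y : mdist (u n y) (u n.+1 y) < h n.
  by case: (sP (n, u n) (ugood n)) => _; exact.
(* The bound is the geometric sum of the [k] steps from [h n] on, in telescoping form. *)
have uclose n k y : mdist (u n y) (u (n + k)%N y) <= 2 * h n - 2 * h (n + k)%N.
  elim: k => [|k IHk]; first by rewrite addn0 mdistxx subrr.
  rewrite (le_trans (metric_triangle _ (u (n + k)%N y) _))// addnS.
  have := ustep (n + k)%N y.
  by have := h0 (n + k)%N; rewrite /h exprS; move: IHk; rewrite /h; lra.
have uclose' n m y : (n <= m)%N -> mdist (u n y) (u m y) < 2 * h n.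
  move=> nm; have := uclose n (m - n)%N y; rewrite subnKC//.
  by have := h0 m; lra.
have h_small e : 0 < e -> exists n, 2 * h n < e.
  move=> e0; near \oo => n; exists n.
  suff : h n < e / 2 by lra.
  by near: n; apply: near_expr2V_lt; lra.
have /choice[f fP] (y : T) : exists x : X, (u ^~ y) @ \oo --> x.
  apply/cvg_ex; apply: cauchy_cvg; apply: cauchy_exP => e e0.
  have [n ne] := h_small e e0.
  exists (u n y); exists n => // m /= nm; rewrite ballEmdist/=.
  exact: lt_trans (uclose' _ _ _ nm) ne.
have uf n y : mdist (u n y) (f y) <= 2 * h n.
  apply/ler_addgt0Pr => e e0; near \oo => m.
  rewrite (le_trans (metric_triangle _ (u m y) _))// lerD//.
    by rewrite ltW// uclose'//; near: m; exact: nbhs_infty_ge.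
  rewrite metric_sym ltW//; near: m.
  by move/(metricType_numDomainType.cvgrPdist_lt): (fP y); apply.
exists f => y.
  apply/(metricType_numDomainType.cvgrPdist_lt) => e e0.
  have [|n ne] := h_small (e / 2); first by lra.
  near=> z.
  rewrite (le_lt_trans (metric_triangle _ (u n y) _))//.
  have := uf n z; have := uf n y.
  have -> : u n z = u n y by near: z; exact: (ugood n).1.
  by rewrite [mdist (f y) _]metric_sym; lra.
apply: Fcl => A /nbhs_ballP[e /= e0 eA].
have [|n ne] := h_small (e / 2); first by lra.
have [x Fx ux] := (ugood n).2 y.
exists x; split => //; apply: eA; rewrite ballEmdist/=.
rewrite (le_lt_trans (metric_triangle _ (u n y) _))//.
by have := uf n y; have := h0 n; rewrite metric_sym; lra.
Unshelve. all: by end_near. Qed.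

(** * A countable clopen base from a dense complement *)

Lemma clopen_basis_of_dense_setC {R : realType} (G : set R) : dense (~` G) ->
  exists B : nat -> set (set_type G),
    (forall n, clopen (B n)) /\ basis (range B).
Proof.
move=> dG.
have cut (x y : R) : x < y -> exists2 c, x < c < y & ~ G c.
  move=> xy; have [||c [/= cxy nGc]] := dG [set` `]x, y[].
  - by exists ((x + y) / 2); rewrite /= in_itv/=; apply/andP; split; lra.
  - exact: interval_open.
  by exists c => //; move: cxy; rewrite in_itv.
(* One cut point per pair of rationals keeps the family countable. A disordered pair also gets a
   point outside [G], so that every [U p] is clopen. *)
have /choice[c cP] (p : rat * rat) : exists c : R, ~ G c /\
    (p.1 < p.2 -> ratr p.1 < c < ratr p.2).
  case: (ltP p.1 p.2) => p12.
    have [|c cp nGc] := cut (ratr p.1) (ratr p.2); first by rewrite ltr_rat.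
    by exists c.
  by have [|c _ nGc] := cut 0 1; [exact: ltr01|exists c].
have between (x y : R) : x < y -> exists p, x < c p < y.
  move=> xy.
  have [p1] := rat_in_itvoo xy; rewrite in_itv/= => /andP[xp1 p1y].
  have [p2] := rat_in_itvoo p1y; rewrite in_itv/= => /andP[p12 p2y].
  exists (p1, p2); have [_] := cP (p1, p2); rewrite -(ltr_rat R).
  move=> /(_ p12)/andP[p1c cp2].
  by rewrite (lt_trans xp1 p1c) (lt_trans cp2 p2y).
have valc : continuous (set_val : set_type G -> R) by exact: initial_continuous.
pose U p : set (set_type G) := set_val @^-1` [set` `]c p.1, c p.2[].
have Ucl p : clopen (U p).
  split; first by apply: open_comp => //; exact: interval_open.
  (* The endpoints lie outside [G], so the open and the closed interval have the same trace. *)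
  have -> : U p = set_val @^-1` [set` `[c p.1, c p.2]].
    apply/seteqP; split => y; rewrite /U /= !in_itv/=.
      by move=> /andP[/ltW-> /ltW->].
    move=> /andP[]; rewrite !le_eqVlt => /orP[/eqP cy|->].
      by case: (cP p.1); rewrite cy => /(_ (set_valP y)).
    by move=> /orP[/eqP cy|->//]; case: (cP p.2); rewrite -cy => /(_ (set_valP y)).
  by apply: preimage_closed => //; exact: interval_closed.
(* Numbers that code nothing get the empty set, which is harmless in a base. *)
pose B n := if unpickle n is Some p then U p else set0.
have Bcl n : clopen (B n).
  rewrite /B; case: unpickle => [p|]; first exact: Ucl.
  by split; [exact: open0|exact: closed0].
exists B; split => //; split => [_ [n _ <-]|y A]; first by case: (Bcl n).
move=> /nbhs_ballP[e /= e0 eA].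
have [|p1 /andP[ep1 p1y]] := between (set_val y - e) (set_val y); first by lra.
have [|p2 /andP[yp2 p2e]] := between (set_val y) (set_val y + e); first by lra.
exists (U (p1, p2)).
  split; last by rewrite /U /= in_itv/= p1y.
  by exists (pickle (p1, p2)) => //; rewrite /B pickleK.
move=> z; rewrite /U /= in_itv/= => /andP[p1z zp2]; apply: eA.
rewrite /ball/= /initial_ball /ball/= ltr_distl; lra.
Qed.

(** * Gaps left by the jumps *)

(** By monotonicity the right limit is the infimum of [g] on []tau, b]], so the [lim] in
    [right_jump] is a genuine limit. *)
Lemma nondecreasing_on_right_limit {R : realType} (a b : R) (g : R -> R)
    (tau : R) : nondecreasing_on a b g -> tau \in `[a, b[ -> exists l,
  [/\ g r @[r --> tau^'+] --> l, g tau <= l &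
      forall r, r \in `]tau, b] -> l <= g r].
Proof.
move=> g_nd; rewrite in_itv/= => /andP[atau taub].
have gin r : r \in `]tau, b] -> g tau <= g r.
  rewrite in_itv/= => /andP[taur rb].
  by apply: g_nd; rewrite ?in_itv/= ?atau ?rb; lra.
have lb : has_lbound (g @` [set` `]tau, b]]).
  by exists (g tau) => _ [r /= rin <-]; exact: gin.
exists (inf (g @` [set` `]tau, b]])); split.
- apply: nondecreasing_at_right_cvgr => // r s.
  rewrite !in_itv/= => /andP[ar rb] /andP[as_ sb]; apply: g_nd.
    by rewrite in_itv/= rb andbT (le_trans atau)// ltW.
  by rewrite in_itv/= sb andbT (le_trans atau)// ltW.
- apply: lb_le_inf; first by exists (g b), b => //=; rewrite in_itv/= taub/=.
  by move=> _ [r /= rin <-]; exact: gin.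
- by move=> r rin; apply: ge_inf => //; exists r.
Qed.

Lemma pure_jump_gap {R : realType} (a b : R) (g : R -> R) (s t : R) :
  nondecreasing_on a b g -> pure_jump_on a b g ->
  s \in `[a, b] -> t \in `[a, b] -> g s < g t ->
  exists2 c, g s < c < g t & ~ (g @` [set` `[a, b]]) c.
Proof.
move=> g_nd g_jump sab tab gst.
have st : s < t by rewrite ltNge; apply/negP => /(g_nd _ _ tab sab); lra.
have [as_ sb] : a <= s /\ s <= b by apply/andP; move: sab; rewrite in_itv.
have [at_ tb] : a <= t /\ t <= b by apply/andP; move: tab; rewrite in_itv.
have [tau taust jump] : exists2 tau, s <= tau < t & right_jump g tau != 0.
  apply: contrapT => nojump.
  (* Without jumps in [[s, t[], the sums for [g s] and [g t] have the same nonzero terms. *)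
  suff : g t - g a = g s - g a by lra.
  apply/EFin_inj; rewrite (g_jump _ sab) (g_jump _ tab).
  rewrite esum_mkcond [RHS]esum_mkcond; apply: eq_esum => tau _.
  rewrite !mem_setE/= !in_itv/=; case: (leP a tau) => //= atau.
  case: (ltP tau s) => [taus|stau]; first by rewrite (lt_trans taus st).
  case: ltP => // taut; congr EFin; apply/eqP; apply: contrapT => /negP jump.
  by apply: nojump; exists tau => //; rewrite stau.
have /andP[stau taut] := taust.
have tauab : tau \in `[a, b[ by rewrite in_itv/=; apply/andP; split; lra.
have [l [gl taul lr]] := nondecreasing_on_right_limit _ _ _ _ g_nd tauab.
have {jump}taul : g tau < l.
  rewrite lt_neqAle taul andbT; apply: contra jump => /eqP gtau.
  by rewrite /right_jump (cvg_lim _ gl)// gtau subrr.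
have lt_ : l <= g t by apply: lr; rewrite in_itv/= taut.
have gstau : g s <= g tau.
  by apply: g_nd => //; rewrite in_itv/=; apply/andP; split; lra.
(* The midpoint of the jump: [g] is at most [g tau] up to [tau] and at least [l] after it. *)
exists ((g tau + l) / 2); first by apply/andP; split; lra.
move=> [r /= rab gr]; case: (leP r tau) => rtau.
  suff : g r <= g tau by lra.
  by apply: g_nd => //; rewrite in_itv/=; apply/andP; split; lra.
suff : l <= g r by lra.
by apply: lr; move: rab; rewrite !in_itv/= rtau => /andP[].
Qed.

(** An open set inside the range would contain a segment whose two ends are values of [g], and the
    gap between these values lies in the segment. *)
Lemma pure_jump_dense_setC {R : realType} (a b : R) (g : R -> R) :
  nondecreasing_on a b g -> pure_jump_on a b g ->
  dense (~` (g @` [set` `[a, b]])).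
Proof.
move=> g_nd g_jump O [x Ox] Oopen; apply: contrapT => noc.
have OG y : O y -> (g @` [set` `[a, b]]) y.
  by move=> Oy; apply: contrapT => nGy; apply: noc; exists y.
have /nbhs_ballP[e /= e0 eO] : nbhs x O by exact: open_nbhs_nbhs.
have Oxe y : x <= y <= x + e / 2 -> O y.
  by move=> xy; apply: eO; rewrite /ball/= ltr_distl; lra.
have [|s sab gs] := OG x; first by [].
have [|t tab gt] := OG (x + e / 2); first by apply: Oxe; lra.
have [|c cst] := pure_jump_gap _ _ _ _ _ g_nd g_jump sab tab; first by rewrite gs gt; lra.
by apply; apply/OG/Oxe; move: cst; rewrite gs gt => /andP[/ltW-> /ltW->].
Qed.

(** * Hausdorff distance between compact sets *)

Lemma compact_mdist_bounded {R : realType} {X : metricType R} (A : set X)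
  (z : X) : compact A -> exists M, forall x, A x -> mdist x z <= M.
Proof.
move=> /compact_near_coveringP cA.
have : \forall M \near +oo, A `<=` (fun x => mdist x z <= M).
  apply: (cA R +oo (fun M x => mdist x z <= M)) => x _.
  near=> x' M => /=; rewrite (le_trans (metric_triangle _ x _))//.
  apply: (@le_trans _ _ (1 + mdist x z)); last first.
    by near: M; apply: nbhs_pinfty_ge; rewrite num_real.
  rewrite lerD2r metric_sym ltW//; near: x'.
  by apply/metricType_numDomainType.nbhs_mdistP; exists 1 => /=.
by move=> /filter_ex[M AM]; exists M.
Unshelve. all: by end_near. Qed.

Lemma hausdorff_dist_lt {R : realType} {X : metricType R} (A B : set X)
  (e : R) (x : X) : compact A -> B !=set0 -> hausdorff_dist A B < e ->
  A x -> exists2 y, B y & mdist x y < e.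
Proof.
move=> cA [b0 Bb0]; rewrite /hausdorff_dist gt_max => /andP[AB _] Ax.
have inf_le z : dist_to_set z B <= mdist z b0.
  apply: ge_inf; last by exists b0.
  by exists 0 => _ [y _ <-]; exact: mdist_ge0.
have [||_ [y By <-] xye] := @inf_lt R [set mdist x y | y in B] e.
- by exists (mdist x b0), b0.
(* [sup] defaults to 0 on unbounded sets, so a bound is needed: the distance to [B] is at most that
   to [b0], which is bounded on the compact [A]. *)
- apply: le_lt_trans AB; apply: ub_le_sup; last by exists x.
  have [M AM] := compact_mdist_bounded A b0 cA.
  by exists M => _ [z Az <-]; exact: le_trans (inf_le z) (AM z Az).
- by exists y.
Qed.

Lemma hausdorff_dist_sym {R : realType} {X : metricType R} (A B : set X) :
  hausdorff_dist A B = hausdorff_dist B A.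
Proof. by rewrite /hausdorff_dist maxC. Qed.

(** Points of [A] are limits of points of [B], and a compact [B] is closed. This makes [F] factor
    through [g]. *)
Lemma hausdorff_dist_lt_all_subset {R : realType} {X : metricType R}
    (A B : set X) :
  nonempty_compacts A -> nonempty_compacts B ->
  (forall e, 0 < e -> hausdorff_dist A B < e) -> A `<=` B.
Proof.
move=> [_ cA] [B0 cB] AB x Ax.
apply: (compact_closed (@metric_hausdorff _ _) cB) => U /nbhs_ballP[e /= e0 eU].
have [y By xy] := hausdorff_dist_lt _ _ _ x cA B0 (AB _ e0) Ax.
by exists y; split => //; apply: eU; rewrite ballEmdist.
Qed.

(** * Passage to the range of [g] and selection there *)

Theorem corollary12p4 (R : realType) (a b : R) (g : R -> R)
    (le_ab : a <= b)
    (g_left : left_continuous_on a b g)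
    (g_nd : nondecreasing_on a b g)
    (g_jump : pure_jump_on a b g) :
  zero_dimensional_space (set_type (g @` [set` `[a, b]])) /\
  (forall (X : completeMetricType R) (F : R -> set X),
     (forall t, t \in `[a, b] -> nonempty_compacts (F t)) ->
     g_continuous_on a b g hausdorff_dist F ->
     forall (theta : R) (x_theta : X), theta \in `[a, b] -> F theta x_theta ->
       exists f : R -> X,
         [/\ g_continuous_on a b g mdist f,
             forall t, t \in `[a, b] -> F t (f t)
           & f theta = x_theta]).
Proof.
have dG := pure_jump_dense_setC a b g g_nd g_jump.
have [B [Bcl Bbasis]] := clopen_basis_of_dense_setC _ dG.
split; first by exists (range B); split => // _ [n _ <-].
move=> X F Fcpt Fcont theta x0 thab Fx0.
set G := g @` [set` `[a, b]] in dG B Bcl Bbasis *.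
have Feq s t : s \in `[a, b] -> t \in `[a, b] -> g s = g t -> F s = F t.
  move=> sab tab gst; apply/seteqP; split; apply: hausdorff_dist_lt_all_subset;
    try exact: Fcpt; move=> e e0.
    have [d d0] := Fcont t tab e e0; apply => //.
    by rewrite gst subrr normr0.
  have [d d0] := Fcont s sab e e0; apply => //.
  by rewrite gst subrr normr0.
(* [s] is an arbitrary section of [g]; by [Feq], [F (s y)] does not depend on the choice. *)
have /choice[s sP] (y : set_type G) : exists t, t \in `[a, b] /\ g t = \val y.
  by have [t tab gt] := set_valP y; exists t.
have Gg t : t \in `[a, b] -> g t \in G by move=> tab; rewrite inE; exists t.
(* Shrinking the value at [g theta] to [x0] preserves lower hemicontinuity,
   although it may destroy Hausdorff continuity. *)
pose Phi (y : set_type G) := [set x | F (s y) x /\ (\val y = g theta -> x = x0)].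
have sval_F t y : t \in `[a, b] -> g t = \val y -> F (s y) = F t.
  move=> tab gt; have [sab gs] := sP y.
  by apply: Feq => //; rewrite gs gt.
have [|||f fcont fPhi] := zero_dimensional_selection B Phi Bcl Bbasis.
- move=> y; have [yth|yth] := eqVneq (\val y) (g theta).
    by exists x0; split => //; rewrite (sval_F theta).
  have [[x Fx] _] := Fcpt _ (sP y).1.
  by exists x; split => // /eqP; rewrite (negbTE yth).
- move=> y; have Fcl : closed (F (s y)).
    by apply: compact_closed; [exact: metric_hausdorff|case: (Fcpt _ (sP y).1)].
  have [yth|yth] := eqVneq (\val y) (g theta).
    have -> : Phi y = [set x0].
      apply/seteqP; split => x; first by case=> _ ->.
      by move=> ->; split => //; rewrite (sval_F theta).
    exact: accessible_closed_set1 (hausdorff_accessible (@metric_hausdorff _ _)) _.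
  have -> // : Phi y = F (s y).
  apply/seteqP; split => x; first by case.
  by move=> Fx; split => // /eqP; rewrite (negbTE yth).
- move=> y x [Fx xth] e e0.
  have [sab gs] := sP y; have [d d0 dF] := Fcont _ sab e e0.
  have Fnear : \forall z \near y, exists2 x', F (s z) x' & mdist x x' < e.
    apply/nbhs_ballP; exists d => //= z; rewrite /ball/= /initial_ball /ball/=.
    move=> yz; have [szab gsz] := sP z.
    apply: (hausdorff_dist_lt (F (s y))) => //.
    - by case: (Fcpt _ sab).
    - by case: (Fcpt _ szab).
    - by rewrite hausdorff_dist_sym; apply: dF => //; rewrite gs gsz distrC.
  have [yth|yth] := eqVneq (\val y) (g theta).
    apply: filterS Fnear => z [x' Fx' xx'].
    (* Here [x] is [x0], so over [g theta] it serves as its own approximation; elsewhere [x'] is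
       unconstrained. *)
    have [zth|zth] := eqVneq (\val z) (g theta).
      exists x; last by rewrite mdistxx.
      by split; [rewrite (sval_F theta)// xth|rewrite xth].
    by exists x' => //; split => // /eqP; rewrite (negbTE zth).
  (* Away from [g theta] the constraint is void on a whole neighbourhood. *)
  have zneq : \forall z \near y, \val z != g theta.
    apply/nbhs_ballP; exists `|\val y - g theta|.
      by rewrite /= normr_gt0 subr_eq0.
    move=> z; rewrite /ball/= /initial_ball /ball/=.
    by apply: contraTneq => <-; rewrite ltxx.
  near=> z; have [x' Fx' xx'] : exists2 x', F (s z) x' & mdist x x' < e by near: z.
  have zth : \val z != g theta by near: z.
  by exists x' => //; split => // /eqP; rewrite (negbTE zth).
pose f' t := if pselect (g t \in G) is left gtG then f (SigSub gtG) else x0.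
have f'E t (tab : t \in `[a, b]) : f' t = f (SigSub (Gg t tab)).
  rewrite /f'; case: pselect => [gtG|]; last by case; exact: Gg.
  by congr f; apply/val_inj.
exists f'; split.
- move=> t tab e e0; rewrite f'E.
  (* Balls of the subtype are traces of balls of the line, so continuity of [f] at [g t] is exactly
     [g]-continuity of [f'] at [t]. *)
  have := fcont (SigSub (Gg t tab)).
  move=> /metricType_numDomainType.cvgrPdist_lt/(_ e e0)/nbhs_ballP[d /= d0 df].
  exists d => // r rab grt; rewrite f'E metric_sym; apply: df.
  by rewrite /ball/= /initial_ball /ball/= distrC.
- move=> t tab; rewrite f'E.
  by have [] := fPhi (SigSub (Gg t tab)); rewrite (sval_F t).
- by rewrite f'E; have [_] := fPhi (SigSub (Gg theta thab)); apply.
Unshelve. all: by end_near. Qed.
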